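(* Let $V$ be one of the three GAN objectives $V_c$ (classic GAN), $V_w$ (Wasserstein GAN with transport cost $c$) or $V_f$ ($f$-GAN), and let $DIV(P_{\theta_g}\|P_r)$ denote $JSD(P_{\theta_g}\|P_r)$ if $V=V_c$, $W_c(P_{\theta_g}\|P_r)$ if $V=V_w$, and $D_f(P_{\theta_g}\|P_r)$ if $V=V_f$. Let $\kappa=\min_{\theta_g'\in\Theta_G} DIV(P_{\theta_g'}\|P_r)\ (\ge 0)$ be the minimum divergence to the real data distribution achievable by the considered class of generators. Then for every $\lambda\ge 0$ and every configuration $(\theta_d,\theta_g)\in\Theta_D\times\Theta_G$, the proximal duality gap satisfies $$DG^{\lambda}(\theta_d,\theta_g)\ \ge\ DIV(P_{\theta_g}\|P_r)-\kappa .$$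
   Context: A GAN game is $\min_{\theta_g\in\Theta_G}\max_{\theta_d\in\Theta_D}V(D_{\theta_d},G_{\theta_g})$, where $\theta_d$ parametrizes a discriminator $D_{\theta_d}$ (a function on the data space) and $\theta_g$ parametrizes a generator $G_{\theta_g}$ inducing a distribution $P_{\theta_g}$ on the data space. $P_r$ is the real data distribution. $P_r$ and all $P_{\theta_g}$ have densities with respect to a common measure $dx$, denoted by the same symbols. We write $V(\theta_d,\theta_g)$ for $V(D_{\theta_d},G_{\theta_g})$. Objectives, for a discriminator $D$: - Classic GAN: $V_c=\frac12\mathbb{E}_{x\sim P_r}[\log D(x)]+\frac12\mathbb{E}_{x\sim P_{\theta_g}}[\log(1-D(x))]$; admissible discriminators are measurable functions with values in $[0,1]$. - Wasserstein GAN: $V_w=\mathbb{E}_{x\sim P_r}[D(x)]-\mathbb{E}_{x\sim P_{\theta_g}}[D^c(x)]$, where $c(x,y)\ge 0$ is a transport cost with $c(x,x)=0$ and $D^c(x)=\sup_y\{D(y)-c(x,y)\}$ is the $c$-transform; admissible discriminators are the $c$-concave functions, i.e. $D(y)=\inf_x\{\varphi(x)+c(x,y)\}$ for some function $\varphi$. - $f$-GAN: $V_f=\mathbb{E}_{x\sim P_r}[D(x)]-\mathbb{E}_{x\sim P_{\theta_g}}[f^*(D(x))]$, where $f:\mathbb{R}_+\to\mathbb{R}$ is convex and lower semi-continuous with $f(1)=0$, and $f^*(x)=\sup_{t\in\mathrm{Dom}(f)}\{xt-f(t)\}$ is its Fenchel conjugate; admissible discriminators are measurable functions with values in the domain of $f^*$.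 Divergences: $JSD$ is the Jensen–Shannon divergence, $JSD(P\|Q)=\frac12 KL(P\|\frac{P+Q}{2})+\frac12 KL(Q\|\frac{P+Q}{2})$; $W_c(P_{\theta_g}\|P_r)=\sup_{D\ c\text{-concave}}\mathbb{E}_{x\sim P_r}[D(x)]-\mathbb{E}_{x\sim P_{\theta_g}}[D^c(x)]$; $D_f(P\|Q)=\int p(x)f\left(\frac{q(x)}{p(x)}\right)dx$. Let $\|\cdot\|$ be a fixed norm (or seminorm) on discriminators. The proximal objective is $V^{\lambda}(\theta_d,\theta_g)=\max_{\tilde\theta_d\in\Theta_D}\{V(D_{\tilde\theta_d},G_{\theta_g})-\lambda\|D_{\tilde\theta_d}-D_{\theta_d}\|^2\}$. The proximal duality gap is $DG^{\lambda}(\theta_d,\theta_g)=V_{D_w}(\theta_g)-V^{\lambda}_{G_w}(\theta_d)$ with $V_{D_w}(\theta_g)=\max_{\theta_d'\in\Theta_D}V(D_{\theta_d'},G_{\theta_g})$ and $V^{\lambda}_{G_w}(\theta_d)=\min_{\theta_g'\in\Theta_G}V^{\lambda}(\theta_d,\theta_g')$. Standing assumptions: for each fixed generator an optimal discriminator $D_w$ exists, i.e. $V_{D_w}(\theta_g)$ is attained in $\Theta_D$, is a real number, and equals the supremum of $V$ over all admissible discriminators. All other displayed maxima and minima are assumed to exist. *)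

(* Defs.v *)
From HB Require Import structures.
From mathcomp Require Import all_boot all_order all_algebra.
From mathcomp Require Import all_classical all_reals all_analysis.
From mathcomp Require Import measurable_realfun.
Import Order.TTheory GRing.Theory Num.Theory.
Import numFieldNormedType.Exports.

Set Implicit Arguments.
Unset Strict Implicit.
Unset Printing Implicit Defensive.

Local Open Scope classical_set_scope.
Local Open Scope ring_scope.
Local Open Scope ereal_scope.

Section extrema.
Context {R : realType} {I : Type}.
Implicit Types F : I -> \bar R.

(* Maxima and minima over a parameter space; genuine ones under [has_max] and
   [has_min]. *)
Definition max_val F : \bar R := ereal_sup (range F).
Definition min_val F : \bar R := ereal_inf (range F).
Definition has_max F : Prop := exists i, F i = max_val F.
Definition has_min F : Prop := exists i, F i = min_val F.

End extrema.

Section transforms.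
Context {R : realType} {T : Type}.

Definition c_transform (c : T -> T -> R) (D : T -> R) (x : T) : \bar R :=
  ereal_sup [set (D y - c x y)%:E | y in [set: T]].

(* Both [D] and [phi] are finite, so the infimum is finite at every point. *)
Definition c_concave (c : T -> T -> R) (D : T -> R) : Prop :=
  exists phi : T -> R, forall y,
    (D y)%:E = ereal_inf [set (phi x + c x y)%:E | x in [set: T]].

Definition transport_cost (c : T -> T -> R) : Prop :=
  (forall x y, (0 <= c x y)%R) /\ (forall x, c x x = 0%R).

(* A function on [0, +oo[ is given by a function on R whose values at negative
   arguments are never used. *)
Definition fenchel (f : R -> R) (y : R) : \bar R :=
  ereal_sup [set (y * t - f t)%:E | t in `[0%R, +oo[%classic].

Definition fdiv_generator (f : R -> R) : Prop :=
  [/\ convex_function (`[0%R, +oo[%classic : set R^o) f,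
      lower_semicontinuous
        (fun t : subspace (`[0%R, +oo[%classic : set R^o) => (f t)%:E)
    & f 1%R = 0%R].

End transforms.

Section objectives.
Context {d : measure_display} {T : measurableType d} {R : realType}.
Implicit Types (P Q : probability T R) (D : T -> R).

Inductive gan_objective : Type :=
  | classic_gan
  | wasserstein_gan of (T -> T -> R)
  | f_gan of (R -> R).

Definition valid_objective (o : gan_objective) : Prop :=
  match o with
  | classic_gan => True
  | wasserstein_gan c => transport_cost c
  | f_gan f => fdiv_generator f
  end.

Definition admissible (o : gan_objective) D : Prop :=
  match o with
  | classic_gan =>
      measurable_fun [set: T] D /\ forall x, (0 <= D x <= 1)%R
  | wasserstein_gan c => c_concave c D
  | f_gan f =>
      measurable_fun [set: T] D /\ forall x, fenchel f (D x) < +oo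
  end.

(* [lne 0 = -oo], so the classic objective takes values in [-oo, 0]. *)
Definition objective_value (o : gan_objective) P Q D : \bar R :=
  match o with
  | classic_gan =>
      2^-1%:E * \int[P]_x lne (D x)%:E
      + 2^-1%:E * \int[Q]_x lne (1 - D x)%:E
  | wasserstein_gan c => \int[P]_x (D x)%:E - \int[Q]_x c_transform c D x
  | f_gan f => \int[P]_x (D x)%:E - \int[Q]_x fenchel f (D x)
  end.

Definition has_expectation P (g : T -> \bar R) : Prop :=
  measurable_fun [set: T] g /\
  (\int[P]_x g^\+ x) +? (- \int[P]_x g^\- x).

(* The library integral and the operations of \bar R are total; an objective
   is meaningful only if both expectations exist and their difference is not
   of the form oo - oo. This is automatic for the classic objective, whose two
   integrands are measurable and nonpositive. *)
Definition objective_defined (o : gan_objective) P Q D : Prop :=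
  match o with
  | classic_gan => True
  | wasserstein_gan c =>
      [/\ has_expectation P (EFin \o D), has_expectation Q (c_transform c D)
        & (\int[P]_x (D x)%:E) +? (- \int[Q]_x c_transform c D x)]
  | f_gan f =>
      [/\ has_expectation P (EFin \o D),
          has_expectation Q (fun x => fenchel f (D x))
        & (\int[P]_x (D x)%:E) +? (- \int[Q]_x fenchel f (D x))]
  end.

Definition objective_sup (o : gan_objective) P Q : \bar R :=
  ereal_sup [set objective_value o P Q D |
             D in [set D | admissible o D /\ objective_defined o P Q D]].

End objectives.
Arguments gan_objective {d} T R.
Arguments classic_gan {d T R}.

Section divergences.
Context {d : measure_display} {T : measurableType d} {R : realType}.
Variable mu : {measure set T -> \bar R}.
Implicit Types (p q : T -> R) (P Q : probability T R).

Definition is_density p P : Prop :=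
  [/\ measurable_fun [set: T] p, (forall x, (0 <= p x)%R)
    & forall A, measurable A -> P A = \int[mu]_(x in A) (p x)%:E].

(* In \bar R, [0^-1 = +oo], [0 * y = 0], [lne 0 = -oo] and [lne +oo = +oo], so
   the integrand is 0 where p = 0 and +oo where p > 0 = q. *)
Definition KL p q : \bar R :=
  \int[mu]_x ((p x)%:E * lne ((p x)%:E / (q x)%:E)).

Definition JSD p q : \bar R :=
  let m x := ((p x + q x) / 2)%R in
  2^-1%:E * KL p m + 2^-1%:E * KL q m.

(* p f(q/p) with the usual conventions 0 f(0/0) = 0 and
   0 f(q/0) = q lim_(t -> +oo) f(t)/t. *)
Definition fdiv_integrand (f : R -> R) (p q : R) : \bar R :=
  if p == 0%R then q%:E * lim ((f t / t)%:E @[t --> +oo%R])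
  else (p * f (q / p))%:E.

Definition f_divergence (f : R -> R) p q : \bar R :=
  \int[mu]_x fdiv_integrand f (p x) (q x).

Definition wasserstein (c : T -> T -> R) Q P : \bar R :=
  objective_sup (wasserstein_gan c) P Q.

(* The divergence DIV(Q || P), [q] and [p] being densities of [Q] and [P]. *)
Definition divergence (o : gan_objective T R) Q q P p : \bar R :=
  match o with
  | classic_gan => JSD q p
  | wasserstein_gan c => wasserstein c Q P
  | f_gan f => f_divergence f q p
  end.

End divergences.

(* A seminorm on a linear space [E] of functions on the data space; [N] is
   irrelevant outside [E]. *)
Definition seminorm_on {R : realType} {T : Type} (E : set (T -> R))
    (N : (T -> R) -> R) : Prop :=
  [/\ E (fun=> 0%R),
      (forall a g h, E g -> E h -> E (fun x => a * g x + h x)%R),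
      (forall g, E g -> (0 <= N g)%R),
      (forall a g, E g -> N (fun x => a * g x)%R = (`|a| * N g)%R)
    & (forall g h, E g -> E h -> (N (fun x => g x + h x) <= N g + N h)%R)].

Section proximal_gap.
Context {R : realType} {T ThetaD ThetaG : Type}.
Variables (V : ThetaD -> ThetaG -> \bar R) (D : ThetaD -> T -> R).
Variables (N : (T -> R) -> R) (lambda : R).

Definition best_response (tg : ThetaG) : \bar R := max_val (V ^~ tg).

Definition proximal_payoff (td : ThetaD) (tg : ThetaG) (td' : ThetaD) :
    \bar R :=
  V td' tg - (lambda * N (fun x => D td' x - D td x) ^+ 2)%:E.

Definition proximal_objective (td : ThetaD) (tg : ThetaG) : \bar R :=
  max_val (proximal_payoff td tg).

Definition worst_proximal (td : ThetaD) : \bar R :=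
  min_val (proximal_objective td).

Definition proximal_duality_gap (td : ThetaD) (tg : ThetaG) : \bar R :=
  best_response tg - worst_proximal td.

End proximal_gap.

(* Main.v *)
Require Import Defs.
From HB Require Import structures.
From mathcomp Require Import all_boot all_order all_algebra.
From mathcomp Require Import all_classical all_reals all_analysis.
From mathcomp Require Import measurable_realfun ring lra.
Import Order.TTheory GRing.Theory Num.Theory.
Import numFieldNormedType.Exports.

Local Open Scope classical_set_scope.
Local Open Scope ring_scope.
Local Open Scope ereal_scope.

(* The penalty is nonnegative, so the worst proximal value is at most the value
   of the best response to a generator minimizing the divergence; it remains to
   see that the best-response value is the divergence up to an additive constant
   (-ln 2 for the classic objective, 0 otherwise). Let [q] be the real density
   and [p] the generated one.
   - Classic: [q ln D + p ln (1 - D)] is maximal pointwise at [D = q / (p + q)].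
   - Wasserstein: the constant is 0 by definition, and [D = 0] gives
     nonnegativity.
   - f-GAN: by Fenchel-Moreau the integrand [p f (q / p)] is the supremum of
     [q y - p f^*(y)] over countably many slopes [y]. Choosing at each point the
     best among the first [n] slopes gives simple admissible discriminators whose
     values increase to the divergence by monotone convergence; the other
     inequality is Fenchel-Young. *)

(** * Expectations as integrals against a density *)

Section density.
Set Implicit Arguments.
Unset Strict Implicit.
Context {d : measure_display} {T : measurableType d} {R : realType}.
Variables (mu : {measure set T -> \bar R}) (P : probability T R) (p : T -> R).
Hypothesis hp : is_density mu p P.

Let mp : measurable_fun [set: T] p. Proof. by case: hp. Qed.
Let mpE : measurable_fun [set: T] (EFin \o p). Proof. exact/measurable_EFinP. Qed.
Let p_ge0 x : (0 <= p x)%R. Proof. by case: hp. Qed.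
Let PE A : measurable A -> P A = \int[mu]_(x in A) (p x)%:E.
Proof. by case: hp => _ _; exact. Qed.

Import HBNNSimple.

Let ge0_integral_density_nnsfun (h : {nnsfun T >-> R}) :
  \int[P]_x (h x)%:E = \int[mu]_x ((h x)%:E * (p x)%:E).
Proof.
under [LHS]eq_integral do rewrite fimfunE -fsumEFin//.
rewrite [LHS]ge0_integral_fsum//; last 2 first.
- by move=> r; exact/measurable_EFinP/measurableT_comp.
- by move=> n x _; rewrite EFinM nnfun_muleindic_ge0.
under [RHS]eq_integral.
  move=> x xD; rewrite fimfunE -fsumEFin// ge0_mule_fsuml; last first.
    by move=> r; rewrite EFinM nnfun_muleindic_ge0.
  over.
rewrite [RHS]ge0_integral_fsum//; last 2 first.
- move=> r; apply: emeasurable_funM => //.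
  by apply/measurable_EFinP; exact: measurableT_comp.
- move=> n x _; apply: mule_ge0; last by rewrite lee_fin.
  by rewrite EFinM nnfun_muleindic_ge0.
apply: eq_fsbigr => r /[!inE] -[t _ <-].
under eq_integral do rewrite EFinM.
under [RHS]eq_integral do rewrite EFinM -muleA.
rewrite !ge0_integralZl//.
- congr (_ * _); rewrite integral_indic// setIT [LHS]PE//.
  rewrite integral_mkcond; apply: eq_integral => x _.
  by rewrite epatch_indic muleC.
- by apply: emeasurable_funM => //; exact/measurable_EFinP.
- by move=> x _; rewrite mule_ge0// lee_fin.
- by rewrite lee_fin.
- exact/measurable_EFinP.
- by rewrite lee_fin.
Qed.

(** Approximation by simple functions reduces this to indicators, where it is the definition of a
    density; monotone convergence passes to the limit on both sides. *)
Lemma ge0_integral_density (g : T -> \bar R) : measurable_fun [set: T] g ->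
  (forall x, 0 <= g x) -> \int[P]_x g x = \int[mu]_x (g x * (p x)%:E).
Proof.
move=> mg g0; pose g_ := nnsfun_approx measurableT mg.
transitivity (limn (fun n => \int[P]_x (g_ n x)%:E)).
  rewrite -monotone_convergence//=.
  - apply: eq_integral => x _; apply/esym/cvg_lim => //=.
    exact: cvg_nnsfun_approx.
  - by move=> n; exact/measurable_EFinP.
  - by move=> n x _; rewrite lee_fin.
  - by move=> x _ a b ab; rewrite lee_fin//; exact/lefP/nd_nnsfun_approx.
transitivity (limn (fun n => \int[mu]_x ((g_ n x)%:E * (p x)%:E))); last first.
  rewrite -monotone_convergence//=.
  - apply: eq_integral => x _; apply/cvg_lim => //=.
    by apply: cvgeZr => //; exact: cvg_nnsfun_approx.
  - by move=> n; apply: emeasurable_funM => //; exact/measurable_EFinP.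
  - by move=> n x _; rewrite mule_ge0// lee_fin.
  - move=> x _ a b ab; rewrite lee_wpmul2r// ?lee_fin//.
    exact/lefP/nd_nnsfun_approx.
by congr (limn _); apply/funext => n; exact: ge0_integral_density_nnsfun.
Qed.

(** Multiplying by [p >= 0] commutes with taking positive and negative parts, so the identity holds
    even when [g] is not integrable. *)
Lemma integral_density (g : T -> \bar R) : measurable_fun [set: T] g ->
  \int[P]_x g x = \int[mu]_x (g x * (p x)%:E).
Proof.
move=> mg; rewrite [LHS]integralE [RHS]integralE.
rewrite !ge0_integral_density//; last 2 first.
- exact: measurable_funeneg.
- exact: measurable_funepos.
congr (_ - _); apply: eq_integral => x _.
- by rewrite !funeposE maxe_pMl ?lee_fin// mul0e.
- by rewrite !funenegE maxe_pMl ?lee_fin// mul0e mulNe.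
Qed.

Lemma integrable_density (g : T -> \bar R) : P.-integrable [set: T] g ->
  mu.-integrable [set: T] (fun x => g x * (p x)%:E).
Proof.
move=> /integrableP[mg goo]; apply/integrableP; split.
  exact: emeasurable_funM.
under eq_integral do rewrite abseM (gee0_abs (_ : 0 <= (p _)%:E)) ?lee_fin//.
by rewrite -ge0_integral_density//; exact: measurableT_comp.
Qed.

Lemma density_integrable : mu.-integrable [set: T] (EFin \o p).
Proof.
apply/integrableP; split => //.
under eq_integral do rewrite /= ger0_norm//.
by rewrite -PE// probability_setT ltry.
Qed.

Lemma integral_density1 : \int[mu]_x (p x)%:E = 1.
Proof. by rewrite -PE// probability_setT. Qed.

End density.

(** * Integrability from a finite expectation *)

Section expectation.
Set Implicit Arguments.
Unset Strict Implicit.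
Context {d : measure_display} {T : measurableType d} {R : realType}.
Variable P : probability T R.

(** A finite difference forces both parts to have finite integrals, and their sum is the integral of
    [|g|]. *)
Lemma has_expectation_integrable (g : T -> \bar R) : has_expectation P g ->
  \int[P]_x g x \is a fin_num -> P.-integrable [set: T] g.
Proof.
move=> [mg def]; rewrite integralE => gfin; apply/integrableP; split => //.
rewrite [X in \int[_]_x X x](_ : _ = abse \o g)// fune_abse.
rewrite ge0_integralD//; last 2 first.
- exact: measurable_funepos.
- exact: measurable_funeneg.
have := integral_ge0 P (fun x (_ : setT x) => funepos_ge0 g x).
have := integral_ge0 P (fun x (_ : setT x) => funeneg_ge0 g x).
move: def gfin.
case: (\int[P]_x g^\+ x) => [a| |]; case: (\int[P]_x g^\- x) => [b| |]//=.
by move=> *; rewrite -EFinD ltry.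
Qed.

End expectation.

(** * Fenchel duality for convex functions on the half-line *)

Section fenchel_duality.
Set Implicit Arguments.
Unset Strict Implicit.
Context {R : realType}.
Variable f : R -> R.
Hypothesis hf : fdiv_generator f.
Local Open Scope ring_scope.

Let f1 : f 1 = 0. Proof. by case: hf. Qed.

Definition affine_minorant (y b : R) := forall t, 0 <= t -> y * t - b <= f t.

Lemma fenchel_le (y b : R) : (fenchel f y <= b%:E)%E <-> affine_minorant y b.
Proof.
split=> [yb t t0|yb].
- have : ((y * t - f t)%:E <= b%:E)%E.
    apply: le_trans yb; apply: ereal_sup_ubound; exists t => //=.
    by rewrite in_itv/= t0.
  by rewrite lee_fin; lra.
- apply: ge_ereal_sup => _ [t /= /[!in_itv]/= /andP[t0 _] <-].
  by rewrite lee_fin; have := yb _ t0; lra.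
Qed.

(** The test point [t = 1] keeps the conjugate away from [-oo]. *)
Lemma fenchel_ge (y : R) : (y%:E <= fenchel f y)%E.
Proof.
apply: ereal_sup_ubound; exists 1 => /=; first by rewrite in_itv/= ler01.
by rewrite f1 mulr1 subr0.
Qed.

Lemma fenchel_fin (y : R) : (fenchel f y < +oo)%E ->
  fenchel f y = (fine (fenchel f y))%:E.
Proof.
move=> yoo; rewrite fineK// fin_numElt yoo andbT.
by rewrite (lt_le_trans _ (fenchel_ge y))// ltNyr.
Qed.

(** Three-slope inequality with denominators cleared: [b] is the convex combination of [a] and [c]
    with weight [(c - b) / (c - a)] on [a]. *)
Lemma fdiv_convex (a b c : R) : 0 <= a -> a < b -> b < c ->
  (f b - f a) * (c - b) <= (f c - f b) * (b - a).
Proof.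
move=> a0 ab bc; have ac : 0 < c - a by lra.
pose t := (c - b) / (c - a).
have t0 : 0 <= t by rewrite divr_ge0; lra.
have t1 : t <= 1 by rewrite ler_pdivrMr//; lra.
have [cf _ _] := hf.
have c0 : 0 <= c by lra.
have cin z : 0 <= z -> z \in (`[0, +oo[%classic : set R^o).
  by move=> z0; rewrite inE /= in_itv/= z0.
have cfac : f (t * a + (1 - t) * c) <= t * f a + (1 - t) * f c.
  exact: (cf (Itv01 t0 t1) a c (cin _ a0) (cin _ c0)).
move: cfac; have -> : t * a + (1 - t) * c = b by rewrite /t; field; lra.
rewrite -(ler_pM2r ac).
have -> : (t * f a + (1 - t) * f c) * (c - a) = (c - b) * f a + (b - a) * f c.
  by rewrite /t; field; lra.
by lra.
Qed.

(** The slope is the supremum of the left difference quotients at [x], which by convexity lie below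
    every right one. *)
Lemma tangent (x : R) : 0 < x ->
  exists y, forall t, 0 <= t -> f x + y * (t - x) <= f t.
Proof.
move=> x0; pose S := [set (f x - f s) / (x - s) | s in [set s | 0 <= s < x]].
have S0 : S !=set0 by exists ((f x - f 0) / (x - 0)), 0 => //=; rewrite lexx.
have Sub t : x < t -> ubound S ((f t - f x) / (t - x)).
  move=> xt _ [s /= /andP[s0 sx] <-].
  rewrite ler_pdivlMr ?subr_gt0// mulrAC ler_pdivrMr ?subr_gt0//.
  exact: fdiv_convex.
exists (sup S) => t t0; have [tx|xt|->] := ltgtP t x; last lra.
- have : (f x - f t) / (x - t) <= sup S.
    apply: ub_le_sup; first by exists ((f (x + 1) - f x) / (x + 1 - x)); apply: Sub; lra.
    by exists t => //=; rewrite t0.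
  by rewrite ler_pdivrMr ?subr_gt0//; lra.
- have : sup S <= (f t - f x) / (t - x) by apply: ge_sup => //; exact: Sub.
  by rewrite ler_pdivlMr ?subr_gt0//; lra.
Qed.

(* The tangent at 1 has slope equal to intercept because [f 1 = 0]. *)
Lemma tangent1 : exists y, affine_minorant y y.
Proof.
have [y hy] := tangent (@ltr01 R); exists y => t /hy.
by rewrite f1; lra.
Qed.

(** At [x > 0] a tangent line reaches [f x]. At [x = 0] the slope of [f] may be infinite, so the
    line is only made to pass above [a]. *)
Lemma fenchel_moreau (x a : R) : 0 <= x -> a < f x ->
  exists y b, affine_minorant y b /\ a < y * x - b.
Proof.
rewrite le_eqVlt => /predU1P[<-|x0] ax; last first.
  have [y hy] := tangent x0; exists y, (y * x - f x); split; last lra.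
  by move=> t /hy; lra.
(* Lower semicontinuity controls [f] near 0; away from 0 a sufficiently negative
   slope keeps the line below the tangent at 1. *)
have [_ lsc _] := hf.
have in0 : (`[0, +oo[%classic : set R^o) 0 by rewrite /= in_itv/= lexx.
have := lsc 0 ((a + f 0) / 2); rewrite lte_fin.
have /[swap]/[apply] : (a + f 0) / 2 < f 0 by lra.
move=> [U /(nbhs_subspace_ex _ in0)[W W0 UW] fU].
have [e /= e0 eW] := W0.
have fe t : 0 <= t -> t < e -> (a + f 0) / 2 < f t.
  move=> t0 te.
  have : (U `&` (`[0, +oo[%classic : set R^o)) t.
    rewrite UW; split; last by rewrite /= in_itv/= t0.
    by apply: eW; rewrite /= sub0r normrN ger0_norm.
  by move=> [/fU]; rewrite lte_fin.
have [y1 hy1] := tangent1.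
have K0 : 0 <= `|(a + f 0) / 2 + y1| / e by rewrite divr_ge0// ltW.
set K := `|_| / e in K0.
have eK : K * e = `|(a + f 0) / 2 + y1| by rewrite /K divfK// gt_eqF.
(* The line starts midway between [a] and [f 0]. A nonpositive slope serves on [[0, e)]; beyond,
   [K * t] absorbs [(a + f 0) / 2 + y1], the excess of its intercept over that of the tangent
   [y1 * t - y1]. *)
exists (Num.min 0 (y1 - K)), (- ((a + f 0) / 2)); split; last first.
  by rewrite mulr0; lra.
move=> t t0; have [te|et] := ltP t e.
- have := fe _ t0 te.
  have : Num.min 0 (y1 - K) * t <= 0 by rewrite mulr_le0_ge0// ge_min lexx.
  lra.
- have : Num.min 0 (y1 - K) * t <= (y1 - K) * t.
    by rewrite ler_wpM2r// ge_min lexx orbT.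
  have : K * e <= K * t by rewrite ler_wpM2l.
  have := hy1 _ t0; have := ler_norm ((a + f 0) / 2 + y1).
  by rewrite -eK; lra.
Qed.

(* The upper end point of the domain of the conjugate of [f]. *)
Definition recession : \bar R :=
  ereal_sup [set y%:E | y in [set y | exists b, affine_minorant y b]].

(** A minorant bounds [f t / t] below by [y - b / t]. Conversely, the tangent at [t], evaluated at 1
    where [f] vanishes, gives [f t <= (t - 1) * z] for a slope [z] at most [recession]. *)
Lemma recession_cvg : ((f t / t)%:E @[t --> +oo%R] --> recession)%E.
Proof.
have low A : (A%:E < recession)%E ->
    exists M, forall t, M < t -> 0 < t /\ A <= f t / t.
  move=> /ereal_sup_gt[_ [y [b yb] <-]]; rewrite lte_fin => Ay.
  exists (`|b| / (y - A)) => t Mt.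
  have t0 : 0 < t by rewrite (le_lt_trans _ Mt)// divr_ge0//; lra.
  split=> //; rewrite ler_pdivlMr//; have := yb _ (ltW t0).
  move: Mt; rewrite ltr_pdivrMr; last lra.
  by have := ler_norm b; lra.
have upp y t : 1 < t -> recession = y%:E -> f t <= (t - 1) * y.
  move=> t1 rs; have t0 : 0 < t by lra.
  have [z hz] := tangent t0.
  have : (z%:E <= y%:E)%E.
    rewrite -rs; apply: ereal_sup_ubound; exists z => //.
    by exists (z * t - f t) => s /hz; lra.
  rewrite lee_fin => zy; have := hz 1 ler01; rewrite f1.
  have : (t - 1) * z <= (t - 1) * y by rewrite ler_wpM2l//; lra.
  by lra.
have [y hy] := tangent1.
have ry : (y%:E <= recession)%E by apply: ereal_sup_ubound; exists y => //; exists y.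
case E : recession => [s| |]; last by move: ry; rewrite E.
- apply: cvg_EFin; first by near=> t.
  apply/cvgrPdist_le => e e0.
  have [|M hM] := low (s - e); first by rewrite E lte_fin; lra.
  near=> t.
  have [|t0 Mt] := hM t; first by near: t; apply: nbhs_pinfty_gt; exact: num_real.
  have t1 : 1 < t by near: t; apply: nbhs_pinfty_gt; exact: num_real.
  (* Ensures [(t - 1) * s <= (s + e) * t], that is, [- s <= e * t]. *)
  have ts : `|s| / e < t by near: t; apply: nbhs_pinfty_gt; exact: num_real.
  rewrite /= ler_distlC; apply/andP; split; first lra.
  rewrite ler_pdivrMr//; have := upp _ _ t1 E.
  by move: ts; rewrite ltr_pdivrMr//; have := ler_norm (- s); rewrite normrN; lra.
- apply/cvgeyPge => A; have [|M hM] := low A; first by rewrite E ltry.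
  near=> t; rewrite lee_fin.
  by have [] := hM t; first by near: t; apply: nbhs_pinfty_gt; exact: num_real.
Unshelve. all: by end_near. Qed.

(** For [p > 0] the minorant at [q / p] is multiplied by [p]; for [p = 0] the slope [y] is at most
    [recession]. *)
Lemma fenchel_young (p q y b : R) : 0 <= p -> 0 <= q -> affine_minorant y b ->
  ((q * y - p * b)%:E <= fdiv_integrand f p q)%E.
Proof.
move=> p0 q0 yb; rewrite /fdiv_integrand; case: eqVneq => [->|pn0].
  rewrite (cvg_lim _ recession_cvg)// mul0r subr0 EFinM lee_wpmul2l ?lee_fin//.
  by apply: ereal_sup_ubound; exists y => //; exists b.
have {pn0}p0 : 0 < p by rewrite lt_neqAle eq_sym pn0.
rewrite lee_fin; have -> : q * y - p * b = p * (y * (q / p) - b) by field; lra.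
by rewrite ler_pM2l// yb// divr_ge0// ltW.
Qed.

(* Lowering the slope [y] to a rational keeps an affine minorant, so rational
   slopes suffice. *)
Lemma fdiv_integrand_sup (p q a : R) : 0 <= p -> 0 <= q ->
  (a%:E < fdiv_integrand f p q)%E ->
  exists r : rat, exists b, affine_minorant (ratr r) b /\ a < q * ratr r - p * b.
Proof.
move=> p0 q0 apq.
suff [y [b [yb ayb]]] : exists y b, affine_minorant y b /\ a < q * y - p * b.
  (* Lowering [y] by less than this quotient costs less than the gap [q * y - p * b - a]; the
     denominator [q + 1] also covers [q = 0]. *)
  have e0 : 0 < (q * y - p * b - a) / (q + 1) by rewrite divr_gt0//; lra.
  have /rat_in_itvoo[r] : y - (q * y - p * b - a) / (q + 1) < y by lra.
  rewrite in_itv/= => /andP[ry yr]; exists r, b; split.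
    move=> t t0; apply: le_trans (yb _ t0).
    by rewrite lerB// ler_wpM2r// ltW.
  have : q * (y - (q * y - p * b - a) / (q + 1)) <= q * ratr r.
    by rewrite ler_wpM2l// ltW.
  have : (q * y - p * b - a) / (q + 1) * (q + 1) = q * y - p * b - a.
    by rewrite divfK// gt_eqF//; lra.
  by lra.
move: apq; rewrite /fdiv_integrand; case: eqVneq => [->|pn0].
  rewrite (cvg_lim _ recession_cvg)//.
  have [->|qn0] := eqVneq q 0.
    rewrite mul0e lte_fin => a0; have [y yy] := tangent1.
    by exists y, y; split => //; lra.
  have {}q0 : 0 < q by rewrite lt_neqAle eq_sym qn0.
  rewrite -lte_pdivrMl// -EFinM => /ereal_sup_gt[_ [y [b yb] <-]].
  rewrite lte_fin ltr_pdivrMl// => ay.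
  by exists y, b; split => //; lra.
have {pn0}p0 : 0 < p by rewrite lt_neqAle eq_sym pn0.
rewrite lte_fin mulrC -ltr_pdivrMr// => /fenchel_moreau[|y [b [yb]]].
  by rewrite divr_ge0// ltW.
rewrite ltr_pdivrMr// => ay; exists y, b; split => //.
by have <- : (y * (q / p) - b) * p = q * y - p * b by field; lra.
Qed.

(** Rational slopes with infinite conjugate are replaced by the tangent slope at 1. That slope also
    sits at index 0, where it will give a discriminator of value 0. *)
Lemma fenchel_dense_sequence : exists y phi : nat -> R,
  [/\ forall n, fenchel f (y n) = (phi n)%:E,
      y 0%N = phi 0%N
    & forall p q a, 0 <= p -> 0 <= q -> (a%:E < fdiv_integrand f p q)%E ->
        exists n, a < q * y n - p * phi n].
Proof.
have [y0 hy0] := tangent1.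
have fy0 : fenchel f y0 = y0%:E.
  by apply/eqP; rewrite eq_le fenchel_ge andbT; exact/fenchel_le.
pose yr r : R := if (fenchel f (ratr r) < +oo)%E then ratr r else y0.
pose y n := if n is m.+1 then oapp yr y0 (@unpickle rat m) else y0.
have yfin n : (fenchel f (y n) < +oo)%E.
  case: n => [|n] /=; first by rewrite fy0 ltry.
  case: unpickle => [r|] /=; last by rewrite fy0 ltry.
  by rewrite /yr; case: ifPn => // _; rewrite fy0 ltry.
exists y, (fun n => fine (fenchel f (y n))); split.
- by move=> n; exact: fenchel_fin.
- by rewrite /= fy0.
- move=> p q a p0 q0 /fdiv_integrand_sup[]// r [b [/fenchel_le rb ab]].
  exists (pickle r).+1; rewrite /= pickleK/= /yr.
  have roo : (fenchel f (ratr r) < +oo)%E by rewrite (le_lt_trans rb)// ltry.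
  rewrite roo; apply: (lt_le_trans ab); rewrite lerB// ler_wpM2l//.
  by rewrite -lee_fin -fenchel_fin.
Qed.

End fenchel_duality.

(** * The f-GAN objective and the f-divergence; here [p] is the real density and [q] the generated
    one *)

Section f_gan_divergence.
Set Implicit Arguments.
Unset Strict Implicit.
Context {d : measure_display} {T : measurableType d} {R : realType}.
Variables (mu : {measure set T -> \bar R}) (P Q : probability T R).
Variables (p q : T -> R) (f : R -> R).
Hypotheses (hp : is_density mu p P) (hq : is_density mu q Q).
Hypothesis hf : fdiv_generator f.

Let mp : measurable_fun [set: T] p. Proof. by case: hp. Qed.
Let mq : measurable_fun [set: T] q. Proof. by case: hq. Qed.
Let p_ge0 x : (0 <= p x)%R. Proof. by case: hp. Qed.
Let q_ge0 x : (0 <= q x)%R. Proof. by case: hq. Qed.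

(** Fenchel-Young is integrated, with slope [D x] and its conjugate as intercept, finite by
    admissibility. *)
Lemma f_gan_value_le (D : T -> R) : admissible (f_gan f : gan_objective T R) D ->
  objective_defined (f_gan f) P Q D ->
  objective_value (f_gan f) P Q D \is a fin_num ->
  mu.-integrable [set: T] (fun x => fdiv_integrand f (q x) (p x)) ->
  objective_value (f_gan f) P Q D <= f_divergence mu f q p.
Proof.
move=> [mD Doo] [eD eF _] /= vfin iF.
have /andP[vP] : (\int[P]_x (D x)%:E \is a fin_num) &&
    (\int[Q]_x fenchel f (D x) \is a fin_num).
  by move: vfin; rewrite fin_numB.
move=> vQ.
have iD : P.-integrable [set: T] (EFin \o D) by exact: has_expectation_integrable.
have iDf : Q.-integrable [set: T] (fun x => fenchel f (D x)).
  exact: has_expectation_integrable.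
rewrite (integral_density hp) ?(integral_density hq); last 2 first.
- by case: eF.
- exact/measurable_EFinP.
have := integrable_density hp iD; have := integrable_density hq iDf.
move=> i1 i2; rewrite -integralB// le_integral//; first exact: integrableB.
move=> x _ /=; rewrite (fenchel_fin hf (Doo x)) -!EFinM -EFinB.
rewrite ![(_ * p x)%R]mulrC ![(_ * q x)%R]mulrC.
by apply: fenchel_young => //; apply/fenchel_le; rewrite -fenchel_fin.
Qed.

Section approximation.
Variables (y phi : nat -> R).
Hypothesis fy : forall n, fenchel f (y n) = (phi n)%:E.

(** The payoff density with respect to [mu] of the constant discriminator [y n], once [phi n] is the
    conjugate at [y n]. *)
Definition score n x : R := (p x * y n - q x * phi n)%R.

(* The discriminator [fun x => y (best n x)] takes finitely many values, so its
   expectations exist, and its payoff density is the largest score among the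
   indices up to [n]. *)
Fixpoint best n x : nat :=
  if n is m.+1 then
    if (score (best m x) x < score n x)%R then n else best m x
  else 0%N.

Lemma best_le n x : (best n x <= n)%N.
Proof. by elim: n => //= n IH; case: ifPn => // _; rewrite ltnW. Qed.

Lemma score_best n i x : (i <= n)%N -> (score i x <= score (best n x) x)%R.
Proof.
elim: n => [|n IH]; first by rewrite leqn0 => /eqP ->.
rewrite leq_eqVlt => /predU1P[->|]; rewrite /= -/(score _ _).
  by case: ltP => // _; rewrite lexx.
by move=> /IH h; case: ltP => // /ltW; exact: le_trans.
Qed.

(** Stated for every [u] because comparing scores in the induction requires the cases [y] and [phi]
    besides [u] itself. *)
Lemma measurable_best (u : nat -> R) n : measurable_fun [set: T] (fun x => u (best n x)).
Proof.
elim: n u => [|n IH] u /=; first exact: measurable_cst.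
under eq_fun do rewrite (fun_if u).
apply: measurable_fun_ifT => //.
by apply: measurable_fun_ltr; apply: measurable_funB; apply: measurable_funM.
Qed.

Lemma integrable_best (M : probability T R) (u : nat -> R) n :
  M.-integrable [set: T] (fun x => (u (best n x))%:E).
Proof.
apply: measurable_bounded_integrable => //.
- by rewrite (le_lt_trans (probability_le1 M measurableT))// ltry.
- exact: measurable_best.
- exists (\sum_(i < n.+1) `|u i|)%R; split; first exact: num_real.
  move=> z uz x _ /=; apply: le_trans (ltW uz).
  have bn : (best n x < n.+1)%N by rewrite ltnS best_le.
  by rewrite (bigD1 (Ordinal bn))//= lerDl sumr_ge0.
Qed.

Lemma integral_score_best n :
  mu.-integrable [set: T] (fun x => (score (best n x) x)%:E) /\
  \int[mu]_x (score (best n x) x)%:E =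
  objective_value (f_gan f) P Q (fun x => y (best n x)).
Proof.
have iP := integrable_best P y n; have iQ := integrable_best Q phi n.
have i1 := integrable_density hp iP; have i2 := integrable_density hq iQ.
have E x : (score (best n x) x)%:E =
    (y (best n x))%:E * (p x)%:E - (phi (best n x))%:E * (q x)%:E.
  by rewrite -!EFinM -EFinB ![(_ * p x)%R]mulrC ![(_ * q x)%R]mulrC.
under eq_fun do rewrite E.
split; first exact: integrableB.
rewrite integralB//= (integral_density hp); last exact: measurable_int iP.
under [X in _ = _ - X]eq_integral do rewrite fy.
by rewrite (integral_density hq)//; exact: measurable_int iQ.
Qed.

Lemma best_objective_le n :
  \int[mu]_x (score (best n x) x)%:E <= objective_sup (f_gan f) P Q.
Proof.
have [_ ->] := integral_score_best n.
have iP := integrable_best P y n.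
have iQ : Q.-integrable [set: T] (fun x => fenchel f (y (best n x))).
  by under eq_fun do rewrite fy; exact: integrable_best.
apply: ereal_sup_ubound; exists (fun x => y (best n x)) => //; split.
- by split; [exact: measurable_best|move=> x; rewrite fy ltry].
- split.
  + by split; [exact: measurable_int iP|exact: integrable_add_def].
  + by split; [exact: measurable_int iQ|exact: integrable_add_def].
  + by rewrite fin_num_adde_defl// fin_numN; exact: integrable_fin_num.
Qed.

End approximation.

(** The best scores may be negative, so monotone convergence is applied after subtracting the score
    of index 0, which has integral 0. Finiteness of the supremum then yields integrability, and that
    score can be added back. *)
Lemma f_divergence_le_sup : objective_sup (f_gan f) P Q < +oo ->
  [/\ mu.-integrable [set: T] (fun x => fdiv_integrand f (q x) (p x)),
      0 <= f_divergence mu f q p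
    & f_divergence mu f q p <= objective_sup (f_gan f) P Q].
Proof.
move=> supoo; have [y [phi [fy y0 dense]]] := fenchel_dense_sequence hf.
pose h n x : \bar R := (score y phi (best y phi n x) x)%:E.
pose F x := fdiv_integrand f (q x) (p x).
have ndh x : nondecreasing_seq (h ^~ x).
  apply/nondecreasing_seqP => n; rewrite lee_fin.
  by apply: score_best; rewrite (leq_trans (best_le _ _ _ _)).
have hF x : h ^~ x @ \oo --> F x.
  rewrite (_ : F x = ereal_sup (range (h ^~ x))).
    exact: ereal_nondecreasing_cvgn.
  apply/eqP; rewrite eq_le; apply/andP; split.
  - have hS n : h n x <= ereal_sup (range (h ^~ x)).
      by apply: ereal_sup_ubound; exists n.
    case E : (ereal_sup _) (hS) => [s| |] hs; [|exact: leey|by have := hs 0%N].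
    rewrite leNgt; apply/negP => /dense[]// n sn.
    have /(lt_le_trans sn) := @score_best y phi n n x (leqnn n).
    by move: (hs n); rewrite lee_fin leNgt => /negP.
  - apply: ge_ereal_sup => _ [n _ <-]; rewrite /h /score.
    by apply: fenchel_young => //; apply/fenchel_le; rewrite fy.
have ih n : mu.-integrable [set: T] (h n) by have [] := integral_score_best fy n.
(* Here [y 0 = phi 0] matters: both measures have mass 1, so the two expectations cancel. *)
have h0 : \int[mu]_x h 0%N x = 0.
  have [_ ->] := integral_score_best fy 0%N; rewrite /= fy.
  by rewrite !integral_cst//= !probability_setT !mule1 y0 subee.
have hF0 n x : h n x <= F x.
  by apply: fenchel_young => //; apply/fenchel_le; rewrite fy.
have mF : measurable_fun [set: T] F.
  apply: (emeasurable_fun_cvg h) => [n|x _]; last exact: hF.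
  exact: measurable_int (ih n).
pose g n x := h n x - h 0%N x.
have ige0 n x : 0 <= g n x by rewrite sube_ge0//; exact: ndh.
have gF x : g ^~ x @ \oo --> F x - h 0%N x.
  by apply: cvgeB => //; [rewrite fin_num_adde_defl|exact: cvg_cst].
have ig n : mu.-integrable [set: T] (g n) by exact: integrableB.
have F0_ge0 x : 0 <= F x - h 0%N x by rewrite sube_ge0.
have F0_le : \int[mu]_x (F x - h 0%N x) <= objective_sup (f_gan f) P Q.
  have -> : \int[mu]_x (F x - h 0%N x) = \int[mu]_x limn (g ^~ x).
    by apply: eq_integral => x _; apply/esym/cvg_lim.
  have ndg x : nondecreasing_seq (g ^~ x).
    by move=> m n mn; apply: leeB => //; exact: ndh.
  rewrite monotone_convergence//; last by move=> n; exact: measurable_int (ig n).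
  apply: lime_le.
    apply: ereal_nondecreasing_is_cvgn => m n mn; apply: le_integral => //.
    by move=> x _; exact: ndg.
  apply: nearW => n; rewrite integralB// h0 sube0.
  exact: best_objective_le.
have iF0 : mu.-integrable [set: T] (fun x => F x - h 0%N x).
  apply/integrableP; split.
    by apply: emeasurable_funB => //; exact: measurable_int (ih 0%N).
  by under eq_integral do rewrite gee0_abs//; exact: le_lt_trans supoo.
have FE : F = (fun x => (F x - h 0%N x) + h 0%N x) by apply/funext => x; rewrite subeK.
have iFE : \int[mu]_x F x = \int[mu]_x (F x - h 0%N x).
  by rewrite [in LHS]FE integralD// h0 adde0.
rewrite /f_divergence -/F iFE; split => //; last exact: integral_ge0.
by rewrite -/F FE; exact: integrableD.
Qed.

End f_gan_divergence.

(** * Pointwise logarithmic inequalities for the classic objective *)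

Section relative_entropy_density.
Set Implicit Arguments.
Unset Strict Implicit.
Context {R : realType}.
Implicit Types a s D : R.

(* A difference of logarithms rather than [ln (a / s)], so that measurability
   in [a] and [s] does not involve measurability of division. *)
Definition xlogx_div a s : R := (a * (ln a - ln s))%R.

Lemma ln_le_sub1 (u : R) : (0 < u)%R -> (ln u <= u - 1)%R.
Proof. by move=> u0; rewrite -{1}(subrKC 1 u) le_ln1Dx//; lra. Qed.

(** Nonpositive since [a <= s]; from below, [ln u <= u - 1] at [u = s / a] gives [a - s]. *)
Lemma xlogx_div_bound a s : (0 <= a)%R -> (a <= s)%R -> (`|xlogx_div a s| <= s)%R.
Proof.
rewrite /xlogx_div le_eqVlt => /predU1P[<-|a0] as_; first by rewrite mul0r normr0.
have s0 : (0 < s)%R by lra.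
have : (ln (s / a) <= s / a - 1)%R by apply: ln_le_sub1; rewrite divr_gt0.
rewrite ln_div ?posrE// => /(ler_wpM2l (ltW a0)) h.
have : (ln a <= ln s)%R by rewrite ler_ln.
rewrite -subr_le0 => /(ler_wpM2l (ltW a0)) h0.
have E : (a * (s / a - 1) = s - a)%R by field; lra.
by rewrite ler_norml; apply/andP; split; lra.
Qed.

(** Halving [s], as the mixture in [JSD] does, produces the [ln 2] term. *)
Lemma KL_term a s : (0 <= a)%R -> (a <= s)%R ->
  a%:E * lne (a%:E / (s / 2)%:E) = (xlogx_div a s)%:E + (ln 2)%:E * a%:E.
Proof.
rewrite /xlogx_div le_eqVlt => /predU1P[<-|a0] as_.
  by rewrite !(mul0r, mul0e, mule0, adde0).
have s0 : (0 < s)%R by lra.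
rewrite inver gt_eqF ?divr_gt0// -EFinM lne_EFin ?divr_gt0 ?divr_gt0//.
by rewrite !ln_div ?posrE ?divr_gt0// -!EFinM -EFinD; congr EFin; ring.
Qed.

(** This is [ln u <= u - 1] at [u = D * s / a]. The linear terms [D * s - a] cancel against those
    for [1 - D] and [s - a]. *)
Lemma lne_cross_le a s D : (0 <= a)%R -> (a <= s)%R -> (0 <= D)%R ->
  lne D%:E * a%:E <= (xlogx_div a s + D * s - a)%:E.
Proof.
rewrite /xlogx_div le_eqVlt => /predU1P[<-|a0] as_.
  by move=> D0; rewrite mule0 mul0r add0r subr0 lee_fin mulr_ge0.
have s0 : (0 < s)%R by lra.
rewrite le_eqVlt => /predU1P[<-|D0].
  by rewrite [lne _]le0_lneNy// gt0_mulNye// leNye.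
rewrite lne_EFin// -EFinM lee_fin.
have : (ln (D * s / a) <= D * s / a - 1)%R by rewrite ln_le_sub1// divr_gt0// mulr_gt0.
rewrite ln_div ?posrE ?mulr_gt0// lnM ?posrE// => /(ler_wpM2l (ltW a0)).
have -> : (a * (D * s / a - 1) = D * s - a)%R by field; lra.
by lra.
Qed.

(** The equality case [D = a / s] of the bound [lne_cross_le]. *)
Lemma lne_cross_opt a s : (0 <= a)%R -> (a <= s)%R ->
  lne (a / s)%:E * a%:E = (xlogx_div a s)%:E.
Proof.
rewrite /xlogx_div le_eqVlt => /predU1P[<-|a0] as_; first by rewrite mule0 mul0r.
have s0 : (0 < s)%R by lra.
by rewrite lne_EFin ?divr_gt0// -EFinM ln_div ?posrE// mulrC.
Qed.

End relative_entropy_density.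

(** * Measurability of logarithms and quotients *)

Section measurability.
Set Implicit Arguments.
Unset Strict Implicit.
Context {d : measure_display} {T : measurableType d} {R : realType}.

Lemma measurable_lne (D : T -> R) : measurable_fun [set: T] D ->
  measurable_fun [set: T] (fun x => lne (D x)%:E).
Proof.
move=> mD; apply: measurable_fun_ifT => //.
- by apply: measurable_fun_ler.
- by apply/measurable_EFinP; apply: measurableT_comp => //; exact: measurable_ln.
Qed.

(** Where [a > 0] the quotient is [expR (ln a - ln b)]; elsewhere [a = 0] and it is 0, even if
    [b = 0]. *)
Lemma measurable_ratio (a b : T -> R) : measurable_fun [set: T] a ->
  measurable_fun [set: T] b -> (forall x, 0 <= a x)%R -> (forall x, a x <= b x)%R ->
  measurable_fun [set: T] (fun x => a x / b x)%R.
Proof.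
move=> ma mb a0 ab.
rewrite (_ : (fun _ => _) =
    (fun x => if (0 < a x)%R then expR (ln (a x) - ln (b x)) else 0%R)).
  apply: measurable_fun_ifT => //; first exact: measurable_fun_ltr.
  apply: measurableT_comp => //; apply: measurable_funB.
    by apply: measurableT_comp => //; exact: measurable_ln.
  by apply: measurableT_comp => //; exact: measurable_ln.
apply/funext => x; case: ltP => [ax|ax].
  have bx := lt_le_trans ax (ab x).
  by rewrite -ln_div ?posrE// lnK// posrE divr_gt0.
by have /le_anti -> : (a x <= 0 <= a x)%R; [rewrite ax a0|rewrite mul0r].
Qed.

End measurability.

(** * The classic objective and the Jensen-Shannon divergence, again with [p] real and [q]
    generated *)

Section classic_gan_divergence.
Set Implicit Arguments.
Unset Strict Implicit.
Context {d : measure_display} {T : measurableType d} {R : realType}.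
Variables (mu : {measure set T -> \bar R}) (P Q : probability T R).
Variables (p q : T -> R).
Hypotheses (hp : is_density mu p P) (hq : is_density mu q Q).

Let mp : measurable_fun [set: T] p. Proof. by case: hp. Qed.
Let mq : measurable_fun [set: T] q. Proof. by case: hq. Qed.
Let p_ge0 x : (0 <= p x)%R. Proof. by case: hp. Qed.
Let q_ge0 x : (0 <= q x)%R. Proof. by case: hq. Qed.
Let s x := (q x + p x)%R.
Let ps x : (p x <= s x)%R. Proof. by rewrite lerDr. Qed.
Let qs x : (q x <= s x)%R. Proof. by rewrite lerDl. Qed.
Let ms : measurable_fun [set: T] s. Proof. exact: measurable_funD. Qed.

Let integrable_xlogx_div (a : T -> R) : measurable_fun [set: T] a ->
  (forall x, 0 <= a x)%R -> (forall x, a x <= s x)%R ->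
  mu.-integrable [set: T] (fun x => (xlogx_div (a x) (s x))%:E).
Proof.
move=> ma a0 as_; apply: (@le_integrable _ _ _ _ _ measurableT _ (EFin \o s)).
- apply/measurable_EFinP; apply: measurable_funM => //; apply: measurable_funB.
    by apply: measurableT_comp => //; exact: measurable_ln.
  by apply: measurableT_comp => //; exact: measurable_ln.
- move=> x _ /=; rewrite lee_fin (le_trans (xlogx_div_bound _ _))//.
  exact: ler_norm.
- rewrite (_ : EFin \o s = (fun x => (q x)%:E + (p x)%:E))//.
  apply: integrableD => //; first exact: density_integrable hq.
  exact: density_integrable hp.
Qed.

Let ip := integrable_xlogx_div mp p_ge0 ps.
Let iq := integrable_xlogx_div mq q_ge0 qs.

Let KL_mixture (a : T -> R) (M : probability T R) : is_density mu a M ->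
  (forall x, a x <= s x)%R ->
  KL mu a (fun x => s x / 2)%R =
  \int[mu]_x (xlogx_div (a x) (s x))%:E + (ln 2)%:E.
Proof.
move=> ha as_; have [ma a0 _] := ha.
rewrite /KL; under eq_integral do rewrite KL_term//.
rewrite integralD//; last 2 first.
- exact: integrable_xlogx_div.
- by apply: integrableZl => //; exact: density_integrable ha.
rewrite integralZl//; last exact: density_integrable ha.
by rewrite (integral_density1 ha) mule1.
Qed.

(** The value at the optimal discriminator [p / s], which is also [JSD] less [ln 2]. *)
Let W := 2^-1%:E * \int[mu]_x (xlogx_div (p x) (s x))%:E
  + 2^-1%:E * \int[mu]_x (xlogx_div (q x) (s x))%:E.

Let W_fin : W \is a fin_num.
Proof. by rewrite fin_numD !fin_numM//; exact: integrable_fin_num. Qed.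

Let JSD_W : JSD mu q p = W + (ln 2)%:E.
Proof.
rewrite /JSD (KL_mixture hq qs) (KL_mixture hp ps) /W.
have := integrable_fin_num measurableT ip.
have := integrable_fin_num measurableT iq.
case: (\int[mu]_x _) => // a _; case: (\int[mu]_x _) => // b _.
by rewrite -!(EFinD, EFinM); congr EFin; lra.
Qed.

Let classic_value_le (D : T -> R) : admissible (classic_gan : gan_objective T R) D ->
  objective_value classic_gan P Q D \is a fin_num ->
  objective_value classic_gan P Q D <= W.
Proof.
move=> [mD D01] /=.
have integrable_lne (g : T -> R) (M : probability T R) : measurable_fun [set: T] g ->
    (forall x, g x <= 1)%R -> 2^-1%:E * \int[M]_x lne (g x)%:E \is a fin_num ->
    M.-integrable [set: T] (fun x => lne (g x)%:E).
  move=> mg g1 fin; apply: has_expectation_integrable; first split.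
  - exact: measurable_lne.
  (* The logarithm of a number at most 1 has zero positive part. *)
  - rewrite fin_num_adde_defr// (eq_integral (cst 0)) ?integral0// => x _.
    by rewrite funeposE; apply/max_idPr; rewrite lne_le0 lee_fin.
  - move: fin; case: (\int[M]_x _) => //.
    + by rewrite gt0_muley// lte_fin invr_gt0.
    + by rewrite gt0_muleNy// lte_fin invr_gt0.
rewrite fin_numD => /andP[finP finQ].
have iP : P.-integrable [set: T] (fun x => lne (D x)%:E).
  by apply: integrable_lne => // x; have /andP[] := D01 x.
have iQ : Q.-integrable [set: T] (fun x => lne (1 - D x)%:E).
  apply: integrable_lne => //; first exact: measurable_funB.
  by move=> x; rewrite gerBl; have /andP[] := D01 x.
have i1 := integrable_density hp iP; have i2 := integrable_density hq iQ.
rewrite (integral_density hp) ?(integral_density hq); last 2 first.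
- exact: measurable_int iQ.
- exact: measurable_int iP.
rewrite /W -!muleDr ?fin_num_adde_defl//; try exact: integrable_fin_num.
rewrite lee_pmul2l ?lte_fin ?invr_gt0// -!integralD//.
apply: le_integral => //; [exact: integrableD|exact: integrableD|].
move=> x _ /=; have /andP[D0 D1] := D01 x.
apply: (le_trans (leeD (lne_cross_le (p_ge0 x) (ps x) D0)
  (lne_cross_le (q_ge0 x) (qs x) _))); first by rewrite subr_ge0.
by rewrite -!EFinD lee_fin /s; lra.
Qed.

Let classic_optimum : exists2 D, admissible (classic_gan : gan_objective T R) D &
  objective_value classic_gan P Q D = W.
Proof.
exists (fun x => p x / s x)%R.
  split; first exact: measurable_ratio.
  move=> x; have := p_ge0 x; have := ps x.
  have [s0 _ _|s0] := eqVneq (s x) 0%R; first by rewrite s0 invr0 mulr0 lexx ler01.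
  move=> psx p0; have {}s0 : (0 < s x)%R by rewrite lt_neqAle eq_sym s0 (le_trans p0).
  by rewrite ler_pdivrMr// mul1r psx andbT divr_ge0// ltW.
have mr : measurable_fun [set: T] (fun x => p x / s x)%R by exact: measurable_ratio.
rewrite /= (integral_density hp); last exact: measurable_lne.
rewrite (integral_density hq); last by apply: measurable_lne; exact: measurable_funB.
congr (_ * _ + _ * _); apply: eq_integral => x _; first by rewrite lne_cross_opt.
(* Where [s x = 0], division by zero makes [1 - p x / s x] equal to 1 and not to [q x / s x], but
   [q x = 0] annihilates the term. *)
have [s0|s0] := eqVneq (s x) 0%R.
  have -> : q x = 0%R by apply/le_anti; rewrite -{1}s0 qs q_ge0.
  by rewrite mule0 /xlogx_div mul0r.
rewrite -(lne_cross_opt (q_ge0 x) (qs x)).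
by have -> : (1 - p x / s x = q x / s x)%R by rewrite /s in s0 *; field.
Qed.

(** The supremum is attained at a finite value, hence is at most [W]; the optimal discriminator
    shows that it is at least [W]. *)
Lemma JSD_objective (D : T -> R) :
  admissible (classic_gan : gan_objective T R) D ->
  objective_value classic_gan P Q D \is a fin_num ->
  objective_value classic_gan P Q D = objective_sup classic_gan P Q ->
  JSD mu q p = objective_sup classic_gan P Q + (ln 2)%:E.
Proof.
move=> aD fD eD; rewrite JSD_W; congr (_ + _).
apply/eqP; rewrite eq_le -{2}eD classic_value_le// andbT.
have [D' aD' <-] := classic_optimum.
by apply: ereal_sup_ubound; exists D'.
Qed.

(** The constant discriminator 1/2 has value [- ln 2], so [W] is at least [- ln 2]. *)
Lemma JSD_ge0 : 0 <= JSD mu q p.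
Proof.
have aH : admissible (classic_gan : gan_objective T R) (cst 2^-1%R : T -> R).
  split; first exact: measurable_cst.
  by move=> x; rewrite /=; apply/andP; split; lra.
have vH : objective_value classic_gan P Q (cst 2^-1%R : T -> R) = (- ln 2)%:E.
  have -> : objective_value classic_gan P Q (cst 2^-1%R : T -> R) =
    2^-1%:E * \int[P]_x (cst (lne (2^-1)%:E)) x
    + 2^-1%:E * \int[Q]_x (cst (lne (2^-1)%:E)) x.
    congr (_ + _ * _); apply: eq_integral => x _.
    by rewrite /cst; congr (lne _%:E); lra.
  rewrite lne_EFin; last lra.
  rewrite !integral_cst//= !probability_setT !mule1.
  by rewrite lnV ?posrE// -!EFinM -EFinD; congr EFin; lra.
have := classic_value_le aH; rewrite vH => /(_ erefl) hW.
rewrite JSD_W -(fineK W_fin) -EFinD lee_fin.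
by move: hW; rewrite -(fineK W_fin) lee_fin; lra.
Qed.

End classic_gan_divergence.

(** * Best-response values as divergences *)

Section divergence_objective.
Set Implicit Arguments.
Unset Strict Implicit.
Context {d : measure_display} {T : measurableType d} {R : realType}.

Lemma wasserstein_ge0 (c : T -> T -> R) (P Q : probability T R) :
  transport_cost c -> 0 <= wasserstein c Q P.
Proof.
move=> [c0 cxx].
(* The supremum is attained at [y = x], because [c] is nonnegative and vanishes on the diagonal. *)
have c_transform0 : c_transform c (fun=> 0%R) = cst 0.
  apply/funext => x; apply/eqP; rewrite eq_le; apply/andP; split.
    by apply: ge_ereal_sup => _ [y _ <-]; rewrite lee_fin sub0r oppr_le0.
  by apply: ereal_sup_ubound; exists x => //; rewrite cxx subr0.
have has0 (M : probability T R) : has_expectation M (cst 0).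
  split; first exact: measurable_cst.
  by have /integrable_add_def := integrable0 M [set: T]; apply.
rewrite /wasserstein /objective_sup; apply: ereal_sup_ubound.
exists (fun=> 0%R); last first.
  by rewrite /= c_transform0 !integral_cst// !mul0e sube0.
split.
- exists (fun=> 0%R) => y; apply/eqP; rewrite eq_le; apply/andP; split.
    by apply: le_ereal_inf_tmp => _ [x _ <-]; rewrite lee_fin add0r.
  by apply: ereal_inf_lbound; exists y => //; rewrite cxx addr0.
- rewrite /objective_defined c_transform0; split; [exact: has0|exact: has0|].
  by rewrite !integral_cst// !mul0e.
Qed.

Definition objective_shift (o : gan_objective T R) : R :=
  if o is classic_gan then ln 2 else 0%R.

Lemma divergence_objective (mu : {measure set T -> \bar R})
    (P Q : probability T R) (p q : T -> R) (o : gan_objective T R) (D : T -> R) :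
  is_density mu p P -> is_density mu q Q -> valid_objective o ->
  admissible o D -> objective_defined o P Q D ->
  objective_value o P Q D \is a fin_num ->
  objective_value o P Q D = objective_sup o P Q ->
  0 <= divergence mu o Q q P p /\
  divergence mu o Q q P p = objective_sup o P Q + (objective_shift o)%:E.
Proof.
move=> hp hq; case: o => [|c|f] ho aD dD fD eD /=.
- split; first exact: JSD_ge0 hp hq.
  exact: (JSD_objective hp hq aD fD eD).
- by rewrite adde0; split => //; exact: wasserstein_ge0.
(* Attainment at a finite value bounds the supremum, which gives the integrability that the
   Fenchel-Young bound requires. *)
- have supoo : objective_sup (f_gan f) P Q < +oo by rewrite -eD ltey_eq fD.
  have [iF F0 Fsup] := f_divergence_le_sup hp hq ho supoo.
  rewrite adde0; split => //; apply/eqP; rewrite eq_le Fsup/= -eD.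
  exact: f_gan_value_le.
Qed.

End divergence_objective.

(** * Comparison of the proximal values with the unpenalized ones *)

Section proximal.
Set Implicit Arguments.
Unset Strict Implicit.
Context {R : realType} {T ThetaD ThetaG : Type}.
Variables (V : ThetaD -> ThetaG -> \bar R) (D : ThetaD -> T -> R).
Variables (N : (T -> R) -> R) (lambda : R).
Hypothesis lambda_ge0 : (0 <= lambda)%R.

Lemma worst_proximal_le td tg : worst_proximal V D N lambda td <= best_response V tg.
Proof.
apply: (@le_trans _ _ (proximal_objective V D N lambda td tg)).
  by apply: ereal_inf_lbound; exists tg.
apply: ge_ereal_sup => _ [td' _ <-].
apply: (@le_trans _ _ (V td' tg)); last by apply: ereal_sup_ubound; exists td'.
by rewrite leeBlDr// leeDl// lee_fin mulr_ge0// sqr_ge0.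
Qed.

End proximal.

Theorem theorem1 (R : realType) (d : measure_display) (T : measurableType d)
  (mu : {measure set T -> \bar R})
  (* real data distribution and its density *)
  (Pr : probability T R) (pr : T -> R) (hpr : is_density mu pr Pr)
  (* discriminators, generated distributions and their densities *)
  (ThetaD ThetaG : Type) (D : ThetaD -> T -> R)
  (P : ThetaG -> probability T R) (p : ThetaG -> T -> R)
  (hp : forall tg, is_density mu (p tg) (P tg))
  (* the objective V *)
  (o : gan_objective T R) (ho : valid_objective o)
  (V : ThetaD -> ThetaG -> \bar R)
  (hV : V = fun td tg => objective_value o Pr (P tg) (D td))
  (hadm : forall td, admissible o (D td))
  (hdef : forall td tg, objective_defined o Pr (P tg) (D td))
  (* the (semi)norm on discriminators *)
  (E : set (T -> R)) (N : (T -> R) -> R) (hN : seminorm_on E N)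
  (hE : forall td, E (D td))
  (* optimal discriminators exist *)
  (hopt : forall tg, [/\ has_max (fun td => V td tg),
                         best_response V tg \is a fin_num
                       & best_response V tg = objective_sup o Pr (P tg)])
  (* the minimal achievable divergence exists *)
  (DIV : ThetaG -> \bar R)
  (hDIV : DIV = fun tg => divergence mu o (P tg) (p tg) Pr pr)
  (hmin : has_min DIV)
  (lambda : R) (hlambda : (0 <= lambda)%R)
  (* the proximal objective and its minimum over the generators exist *)
  (hprox : forall td tg, has_max (proximal_payoff V D N lambda td tg))
  (hworst : forall td, has_min (proximal_objective V D N lambda td))
  (td : ThetaD) (tg : ThetaG) :
  let kappa := min_val DIV in
  0 <= kappa /\
  DIV tg - kappa <= proximal_duality_gap V D N lambda td tg.
Proof.
have key t : 0 <= DIV t /\ DIV t = best_response V t + (objective_shift o)%:E.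
  have [[td' emax] fin supE] := hopt t.
  have emax' : V td' t = best_response V t := emax.
  have VE : V td' t = objective_value o Pr (P t) (D td') by rewrite hV.
  rewrite hDIV supE; apply: (divergence_objective (D := D td')) => //.
  - by rewrite -VE emax'.
  - by rewrite -VE emax'.
have [tg0 <-] := hmin; split; first by have [] := key tg0.
have [_ ->] := key tg; have [_ ->] := key tg0.
have [_ fin _] := hopt tg; have [_ fin0 _] := hopt tg0.
(* The shift is the same for both generators and cancels, the best-response values being finite. *)
apply: (@le_trans _ _ (best_response V tg - best_response V tg0)).
  rewrite -(fineK fin) -(fineK fin0) -!EFinD lee_fin.
  by rewrite opprD addrACA subrr addr0.
by apply: leeB => //; exact: worst_proximal_le.
Qed.
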